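(* Let $M$ be a compact, connected topological manifold of dimension greater than or equal to $2$, and let $f:M\to M$ be a homeomorphism that has a wandering point. Then $h(C(f))=\infty$, where $C(f):C(M)\to C(M)$ is the map induced by $f$ on the hyperspace of subcontinua of $M$.
   Context: For a compact metric space $(X,d)$, $2^X$ is the set of all nonempty closed subsets of $X$ with the Hausdorff metric $d_H(A,B)=\inf\{\varepsilon>0 : A\subset U_\varepsilon(B),\ B\subset U_\varepsilon(A)\}$, where $U_\varepsilon(A)=\{x\in X : d(x,A)<\varepsilon\}$. $C(X)\subset 2^X$ is the subspace of all nonempty closed connected subsets of $X$. A continuous $f:X\to X$ induces $2^f:2^X\to 2^X$, $2^f(A)=\{f(x): x\in A\}$, and $C(f)=2^f|_{C(X)}:C(X)\to C(X)$. A point $x\in X$ is wandering for $f$ if there is a neighbourhood $U\ni x$ with $f^n(U)\cap U=\emptyset$ for all $n\ge 1$. Topological entropy: for a continuous map $g$ of a compact metric space $(Z,\rho)$ put $\rho_n^g(x,y)=\max_{0\le j\le n-1}\rho(g^j(x),g^j(y))$; a finite set $E$ is $(n,\varepsilon)$-separated if $\rho_n^g(x,y)\ge\varepsilon$ for all distinct $x,y\in E$; $\mathrm{sep}(n,\varepsilon)$ is the maximal cardinality of an $(n,\varepsilon)$-separated subset of $Z$; and $$h(g)=\lim_{\varepsilon\to0}\limsup_{n\to\infty}\frac{\log\mathrm{sep}(n,\varepsilon)}{n}\in[0,\infty].$$ The value does not depend on the metric inducing the topology. *)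

(* Defs.v *)
From HB Require Import structures.
From mathcomp Require Import all_boot all_order all_algebra finmap.
From mathcomp Require Import all_classical all_reals all_analysis.

Set Implicit Arguments.
Unset Strict Implicit.
Unset Printing Implicit Defensive.
Import Order.TTheory GRing.Theory Num.Theory.
Import numFieldNormedType.Exports.
Local Open Scope classical_set_scope.
Local Open Scope ring_scope.

Section manifold.

(* A topological n-manifold without boundary; [phi : U -> phi @` U] is a chart
   at x and [psi], restricted to [phi @` U], its inverse. *)
Definition topological_manifold (R : realType) (n : nat)
    (M : topologicalType) : Prop :=
  [/\ hausdorff_space M, @second_countable M &
    forall x : M, exists (U : set M) (phi : M -> 'rV[R]_n) (psi : 'rV[R]_n -> M),
      [/\ open_nbhs x U, open (phi @` U),
          {within U, continuous phi}, {within phi @` U, continuous psi} &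
          forall y, U y -> psi (phi y) = y]].

Definition homeomorphism (T U : topologicalType) (f : T -> U) : Prop :=
  continuous f /\
  exists g : U -> T, [/\ continuous g, cancel f g & cancel g f].

Definition wandering (T : topologicalType) (f : T -> T) (x : T) : Prop :=
  exists2 U : set T, nbhs x U &
    forall n, (1 <= n)%N -> (iter n f @` U) `&` U = set0.

End manifold.

Section entropy.
Context {R : realType} {Z : metricType R}.
Variable g : Z -> Z.

Definition bowen_dist (n : nat) (x y : Z) : R :=
  \big[Num.max/0]_(j < n) mdist (iter j g x) (iter j g y).

Definition separated (n : nat) (eps : R) (E : {fset Z}) : Prop :=
  forall x y, x \in E -> y \in E -> x != y -> eps <= bowen_dist n x y.

(* The supremum is taken in the extended reals; on a compact space with g
   continuous and eps > 0 it is a finite maximum. *)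
Definition sep (n : nat) (eps : R) : \bar R :=
  ereal_sup [set (#|` E|)%:R%:E | E in separated n eps].

Definition topological_entropy : \bar R :=
  lim ((limn_esup (fun n => (lne (sep n eps) * (n%:R^-1)%:E)%E))
       @[eps --> 0^'+]).

End entropy.

Section hausdorff_distance.
Context {R : realType} {M : metricType R}.
Implicit Types A B : set M.

Definition dist_to_set (x : M) A : R := inf [set mdist x a | a in A].

Definition thickening (eps : R) A : set M := [set x | dist_to_set x A < eps].

Definition hausdorff_dist A B : R :=
  inf [set eps | 0 < eps /\ A `<=` thickening eps B /\ B `<=` thickening eps A].

Lemma thickeningP eps A x : A !=set0 ->
  thickening eps A x <-> exists2 a, A a & mdist x a < eps.
Proof.
move=> [a0 Aa0]; split => [|[a Aa xa]].
  rewrite /thickening/= /dist_to_set => /inf_lt[|_ [a Aa <-] xa].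
    by exists (mdist x a0), a0.
  by exists a.
apply: le_lt_trans xa; apply: ge_inf; last by exists a.
by exists 0 => _ [b _ <-]; exact: mdist_ge0.
Qed.

Lemma mdist_bounded : compact [set: M] ->
  exists2 D : R, 0 < D & forall x y : M, mdist x y < D.
Proof.
move=> cM; have [[x0 _]|M0] := pselect ([set: M] !=set0); last first.
  by exists 1 => // x; exfalso; apply: M0; exists x.
have cd : continuous (mdist x0 : M -> R).
  move=> x; apply/cvgrPdist_lt => e e0.
  apply: (filterS _ (nbhsx_ballx x e e0)) => y; rewrite ballEmdist/=.
  apply: le_lt_trans; rewrite ler_distl lerBlDr metric_triangle/=.
  by rewrite (metric_sym x y) metric_triangle.
have T0 : [set: M] !=set0 by exists x0.
have [c _ cmax] := compact_EVT_max T0 cM (continuous_subspaceT cd).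
exists (mdist x0 c + mdist x0 c + 1) => [|x y].
  by rewrite ltr_wpDl// addr_ge0// mdist_ge0.
rewrite (le_lt_trans (metric_triangle _ x0 _))// (metric_sym x x0).
by rewrite ltr_pwDr// lerD// cmax// in_setT.
Qed.

End hausdorff_distance.

(* The compactness proof is a parameter of the type so that the Hausdorff
   distance, which is only a metric for bounded sets, can be made canonical. *)
Record subcontinuum (R : realType) (M : metricType R)
    (cM : compact [set: M]) := Subcontinuum {
  subcontinuum_set :> set M ;
  subcontinuum_neq0 : subcontinuum_set !=set0 ;
  subcontinuum_closed : closed subcontinuum_set ;
  subcontinuum_connected : connected subcontinuum_set }.

HB.instance Definition _ (R : realType) (M : metricType R)
  (cM : compact [set: M]) := gen_eqMixin (subcontinuum cM).
HB.instance Definition _ (R : realType) (M : metricType R)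
  (cM : compact [set: M]) := gen_choiceMixin (subcontinuum cM).

Section subcontinuum_metric.
Context {R : realType} {M : metricType R} (cM : compact [set: M]).
Implicit Types A B C : subcontinuum cM.

Lemma subcontinuum_inj A B : A = B :> set M -> A = B.
Proof.
case: A B => [A A0 Ac Ak] [B B0 Bc Bk] /= AB; subst B.
by congr Subcontinuum; exact: Prop_irrelevance.
Qed.

Let near_sets (A B : set M) :=
  [set eps : R | 0 < eps /\ A `<=` thickening eps B /\ B `<=` thickening eps A].

Let near_sets_has_inf A B : has_inf (near_sets A B).
Proof.
split; last by exists 0 => e [/ltW].
have [D D0 DM] := mdist_bounded cM; exists D; split => //.
have [a Aa] := subcontinuum_neq0 A; have [b Bb] := subcontinuum_neq0 B.
split=> x _; apply/thickeningP; [by exists b | by exists b | by exists a|].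
by exists a.
Qed.

Lemma hausdorff_dist_lt A B (e : R) : hausdorff_dist A B < e ->
  (forall a, (A : set M) a -> exists2 b, (B : set M) b & mdist a b < e) /\
  (forall b, (B : set M) b -> exists2 a, (A : set M) a & mdist b a < e).
Proof.
move=> /(inf_lt (proj1 (near_sets_has_inf A B)))[d [d0 [AB BA]] de].
split=> [a /AB|b /BA] /thickeningP => [/(_ (subcontinuum_neq0 B))|
    /(_ (subcontinuum_neq0 A))] [c cc /lt_trans/(_ de) ?]; by exists c.
Qed.

Lemma hausdorff_dist_le A B (e : R) : 0 < e ->
  (forall a, (A : set M) a -> exists2 b, (B : set M) b & mdist a b < e) ->
  (forall b, (B : set M) b -> exists2 a, (A : set M) a & mdist b a < e) ->
  hausdorff_dist A B <= e.
Proof.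
move=> e0 AB BA; apply: ge_inf; first by case: (near_sets_has_inf A B).
split=> //; split => [a /AB|b /BA] ?; apply/thickeningP => //;
  exact: subcontinuum_neq0.
Qed.

Lemma hausdorff_dist_ge0 A B : 0 <= hausdorff_dist A B.
Proof.
by apply: lb_le_inf; [case: (near_sets_has_inf A B) | move=> e [/ltW]].
Qed.

Let hdistxx A : hausdorff_dist A A = 0.
Proof.
apply/eqP; rewrite eq_le hausdorff_dist_ge0 andbT.
apply/ler_addgt0Pl => e e0; rewrite addr0.
by apply: hausdorff_dist_le => // a Aa; exists a => //; rewrite mdistxx.
Qed.

Let hdist_sym A B : hausdorff_dist A B = hausdorff_dist B A.
Proof.
by congr inf; apply/seteqP; split=> e /= [e0 [? ?]]; split.
Qed.

Let hdist_positivity A B : hausdorff_dist A B = 0 -> A = B.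
Proof.
have sub (C D : subcontinuum cM) : hausdorff_dist C D = 0 -> C `<=` D.
  move=> CD0 x Cx; apply: (subcontinuum_closed (s := D)).
  move=> V /nbhs_ballP[e /= e0 xV].
  have := @hausdorff_dist_lt C D e.
  rewrite CD0 => /(_ e0)[/(_ _ Cx)[y Dy xy] _].
  by exists y; split => //; apply: xV; rewrite ballEmdist.
move=> AB0; apply: subcontinuum_inj; apply/seteqP.
by split; apply: sub => //; rewrite hdist_sym.
Qed.

Let hdist_triangle B A C :
  hausdorff_dist A C <= hausdorff_dist A B + hausdorff_dist B C.
Proof.
apply/ler_addgt0Pl => e e0; rewrite [e]splitr addrACA.
have e20 : 0 < e / 2 by rewrite divr_gt0.
have /hausdorff_dist_lt[AB BA] : hausdorff_dist A B < e / 2 + hausdorff_dist A B.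
  by rewrite ltrDr.
have /hausdorff_dist_lt[BC CB] : hausdorff_dist B C < e / 2 + hausdorff_dist B C.
  by rewrite ltrDr.
apply: hausdorff_dist_le.
- by rewrite addr_gt0// ltr_pwDl// hausdorff_dist_ge0.
- move=> a /AB[b /BC[c Cc bc] ab]; exists c => //.
  by rewrite (le_lt_trans (metric_triangle _ b _))// ltrD.
- move=> c /CB[b /BA[a Aa ba] cb]; exists a => //.
  by rewrite (le_lt_trans (metric_triangle _ b _))// addrC ltrD.
Qed.

HB.instance Definition _ := isMetric.Build R (subcontinuum cM)
  hdistxx hdist_positivity hdist_sym hdist_triangle.

Lemma mdist_subcontinuumE A B : mdist A B = hausdorff_dist A B.
Proof. by []. Qed.

Variables (f : M -> M) (cf : continuous f).

Let image_neq0 A : f @` A !=set0.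
Proof. by have [a Aa] := subcontinuum_neq0 A; exists (f a), a. Qed.

Let image_closed A : closed (f @` A).
Proof.
apply: compact_closed; first exact: metric_hausdorff.
apply: continuous_compact; first exact: continuous_subspaceT.
exact: subclosed_compact (subcontinuum_closed (s := A)) cM (@subsetT _ _).
Qed.

Let image_connected A : connected (f @` A).
Proof.
apply: connected_continuous_connected; first exact: subcontinuum_connected.
exact: continuous_subspaceT.
Qed.

Definition subcontinuum_map A : subcontinuum cM :=
  Subcontinuum cM (image_neq0 A) (@image_closed A) (@image_connected A).

End subcontinuum_metric.

Arguments subcontinuum_map {R M} cM {f} cf A.

(* Main.v *)
Require Import Defs.
From mathcomp Require Import all_boot all_order all_algebra finmap.
From mathcomp Require Import all_classical all_reals all_analysis.
From mathcomp Require Import lra.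
Set Implicit Arguments.
Unset Strict Implicit.
Unset Printing Implicit Defensive.
Import Order.TTheory GRing.Theory Num.Theory.
Import numFieldNormedType.Exports.
Local Open Scope classical_set_scope.
Local Open Scope ring_scope.

(** The idea is to record an arbitrary word by drilling one hole per letter out
of the whole manifold.

Let [V] be an open set on which [f] wanders: an orbit visits [V] at most once.
Inside a chart, choose concentric open cubes [B 0], [B 1], ... whose hulls lie
in the open cube [V] ([nested_cells_exist]).  To a word [s] of length [m] over
[k] letters attach
  [A s = {x | f^j x is outside B (s j) for all j < m}].

- [A s] is a continuum.  It is obtained from [M] by removing successively the
  sets [f^-j (B (s j))].  At each stage the set removed lies well inside
  [f^-j V], which the earlier holes do not meet, and the shell left around it is
  a homeomorphic copy of [V \ B (s j)].  Removing such a set from a connected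
  set leaves it connected as soon as the shell is connected
  ([connected_setD]), and a shell between two concentric cubes is connected in
  dimension at least 2 ([cube_shell_connected]).

- Different words give separated orbits in the hyperspace.  As [V] wanders, the
  only hole of [f^j (A s)] inside [V] is [B (s j)].  If [s j < t j], then a point
  [q (s j)] lying in [B (s j).+1] but not in [B (s j)] belongs to [f^j (A s)],
  while [f^j (A t)] misses the neighbourhood [B (s j).+1] of that point.  Hence
  the Hausdorff distance of these two sets is at least some [e > 0] that depends
  on [k] alone.

So for each [k] there is [e > 0] with [sep m e >= k ^ m] for all [m], which gives
entropy at least [ln k] ([entropy_pinfty]). *)

(** * Removing a cell from a connected set *)

(** A relatively clopen part [D] of [A \ B] either misses the shell [V \ B] or
contains it.  In the first case [D] is already clopen in [A], in the second
[D] together with [B] is; [K] keeps the boundary of [B] inside [V].  A nonempty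
shell excludes that [D] is all of [A] in the first case. *)
Lemma connected_setD (T : topologicalType) (A V K B : set T) :
  connected A -> connected (V `\` B) -> V `\` B !=set0 ->
  open V -> closed K -> open B -> B `<=` K -> K `<=` V -> V `<=` A ->
  connected (A `\` B).
Proof.
move=> cA cVB [v [Vv nBv]] oV clK oB BK KV VA D D0 [C oC DC] [F clF DF].
have [[w [[Vw nBw] Dw]]|VBD] := pselect ((V `\` B) `&` D !=set0).
- have VBD : V `\` B `<=` D.
    have <- : (V `\` B) `&` D = V `\` B; last by move=> x [].
    apply: cVB; first by exists w.
    + exists C => //; rewrite DC; apply/seteqP.
      by split=> x /=; have := VA x; tauto.
    + exists F => //; rewrite DF; apply/seteqP.
      by split=> x /=; have := VA x; tauto.
  have DBA : D `|` B = A.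
    apply: cA; first by exists w; left.
    + exists (C `|` V); first exact: openU.
      apply/seteqP; split=> x /=; have := VA x; have := KV x; have := BK x;
        have := VBD x; rewrite DC /=; have [Bx|Bx] := pselect (B x); tauto.
    + exists (F `|` K); first exact: closedU.
      apply/seteqP; split=> x /=; have := VA x; have := KV x; have := BK x;
        have := VBD x; rewrite DF /=; have [Bx|Bx] := pselect (B x); tauto.
  rewrite -DBA; apply/seteqP; split=> x /=; last tauto.
  by rewrite DC /=; tauto.
- have VD x : V x -> D x -> False.
    move=> Vx Dx; apply: VBD; exists x; split=> //; split=> //.
    by move: Dx; rewrite DC => -[[]].
  have DA : D = A.
    apply: cA => //.
    + exists (C `&` ~` K); first by apply: openI => //; exact: closed_openC.
      apply/seteqP; split=> x /=; have := KV x; have := BK x;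
        have := VD x; rewrite DC /=; tauto.
    + exists (F `&` ~` B); first by apply: closedI => //; exact: open_closedC.
      by apply/seteqP; split=> x /=; rewrite DF /=; tauto.
  by exfalso; apply: VBD; exists v; split => //; rewrite DA; exact: VA.
Qed.

(** * Shells between concentric cubes *)

Definition cube (R : realType) n (c : 'rV[R]_n) (r : R) : set 'rV[R]_n :=
  [set y | forall j, `|y ord0 j - c ord0 j| < r].

Lemma cube_ball (R : realType) n (c : 'rV[R]_n) (r : R) :
  0 < r -> cube c r = ball c r.
Proof.
move=> r0; apply/seteqP; split=> y.
  by move=> cy; split=> // i j; rewrite (ord1 i) -ball_normE /ball_/= distrC.
by move=> [_ +] j => /(_ ord0 j); rewrite -ball_normE /ball_/= distrC.
Qed.

Lemma closed_cube_compact (R : realType) n (c : 'rV[R]_n) (r : R) :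
  compact [set y : 'rV[R]_n | forall j, `|y ord0 j - c ord0 j| <= r].
Proof.
rewrite (_ : mkset _ = [set v : 'rV[R]_n | forall i,
    v ord0 i \in `[c ord0 i - r, c ord0 i + r]]).
  apply: (@rV_compact _ _ 
    (fun i => `[c ord0 i - r, c ord0 i + r]%classic)) => i.
  exact: segment_compact.
by apply/seteqP; split=> y /= H j; move: (H j); rewrite in_itv /= ler_distl.
Qed.

(** The part of a cube lying across one of the faces of a smaller cube; [s] is
the sign of the face.  The shell between the two cubes is a union of such slabs,
and these are convex. *)
Definition slab (R : realType) n (c : 'rV[R]_n) (a b : R) (j : 'I_n)
    (s : bool) : set 'rV[R]_n :=
  [set y | cube c b y /\ a <= (-1) ^+ s * (y ord0 j - c ord0 j)].

Lemma segment_image_connected (R : realType) (W : normedModType R)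
    (x y : W) :
  connected ((fun t : R => x + t *: (y - x)) @` `[0, 1]).
Proof.
apply: connected_continuous_connected; first exact: segment_connected.
apply: continuous_subspaceT => t; apply: cvgD; first exact: cvg_cst.
by apply: cvgZr_tmp; exact: cvg_id.
Qed.

Lemma convex_connected (R : realType) (W : normedModType R) (A : set W) :
  (forall x y (t : R), A x -> A y -> 0 <= t <= 1 -> A (x + t *: (y - x))) ->
  connected A.
Proof.
move=> cA; have [[x Ax]|A0] := pselect (A !=set0); last first.
  by rewrite (_ : A = set0); [exact: connected0|apply: contrapT => /eqP/set0P].
rewrite (_ : A = \bigcup_(y in A)
    ((fun t : R => x + t *: (y - x)) @` `[0, 1])).
  apply: bigcup_connected => [|y _]; last exact: segment_image_connected.
  by exists x => y _; exists 0; rewrite ?scale0r ?addr0//= in_itv /= lexx ler01.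
apply/seteqP; split=> [y Ay|z [y Ay [t t01 <-]]].
  by exists y => //; exists 1; rewrite ?scale1r ?subrKC//= in_itv /= ler01 lexx.
by apply: cA => //; move: t01; rewrite /= in_itv.
Qed.

Lemma slab_connected (R : realType) n (c : 'rV[R]_n) (a b : R) j s :
  connected (slab c a b j s).
Proof.
apply: convex_connected => x y t [xb ax] [yb ay] /andP[t0 t1]; split=> [i|].
  rewrite !mxE; move: (xb i) (yb i).
  rewrite !ltr_norml => /andP[x1 x2] /andP[y1 y2].
  by have [xy|xy] := leP (x ord0 i) (y ord0 i); apply/andP; split; nra.
by rewrite !mxE; move: ax ay; case: s; rewrite ?expr1 ?expr0; nra.
Qed.

(** The common point is a corner of the inner cube within the coordinate plane of
[i] and [j]. *)
Lemma slab_meet (R : realType) n (c : 'rV[R]_n) (a b : R) i j s t :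
  0 < a < b -> i != j -> slab c a b i s `&` slab c a b j t !=set0.
Proof.
move=> /andP[a0 ab] ij.
exists (\row_l (c ord0 l + (if l == i then (-1) ^+ s * a
                            else if l == j then (-1) ^+ t * a else 0))).
have inb l : `|(if l == i then (-1) ^+ s * a
    else if l == j then (-1) ^+ t * a else 0)| < b.
  by case: ifP => _; last case: ifP => _;
    rewrite ?normrMsign ?normr0 ?gtr0_norm// (lt_trans a0).
split; split=> [l|]; rewrite !mxE /= ?[c _ _ + _]addrC ?addrK ?eqxx//.
  by rewrite mulrA -signr_addb addbb mul1r.
by rewrite eq_sym (negbTE ij) mulrA -signr_addb addbb mul1r.
Qed.

(** The shell is the union of the slabs.  Every slab in a direction other than the
first meets the slab on the first positive face, so their union with it is
connected.  The slab on the first negative face does not meet it, but is joined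
to it through a slab in the second direction: this is where the dimension
enters. *)
Lemma cube_shell_connected (R : realType) n (c : 'rV[R]_n) (a b : R) :
  (2 <= n)%N -> 0 < a < b -> connected (cube c b `\` cube c a).
Proof.
case: n c => [|[|n]]// c _ ab; pose S := slab c a b.
pose i1 : 'I_n.+2 := lift ord0 ord0.
have sub j s : S j s `<=` cube c b `\` cube c a.
  move=> y [yb ay]; split => // /(_ j).
  by rewrite ltNge -(normrMsign s) (le_trans ay)// ler_norm.
rewrite (_ : _ `\` _ = \bigcup_(js in [set: 'I_n.+2 * bool])
    (if js.1 == ord0 then S ord0 false `|` (S i1 false `|` S ord0 js.2)
     else S ord0 false `|` S js.1 js.2)).
  apply: bigcup_connected => [|[j s] _ /=].
    have [p [p0 _]] := @slab_meet R _ c a b ord0 i1 false false ab isT.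
    by exists p => -[j s] _ /=; case: ifP => _; left.
  have [_|j0] := eqVneq j ord0.
    apply: connectedU; last apply: connectedU; try exact: slab_connected.
      have [p [p0 p1]] := @slab_meet R _ c a b ord0 i1 false false ab isT.
      by exists p; split=> //; left.
    exact: slab_meet.
  apply: connectedU; try exact: slab_connected.
  by apply: slab_meet; rewrite // eq_sym.
apply/seteqP; split=> [y [yb /existsNP[j /negP]]|y [[j s] _ /=]]; last first.
  by case: eqVneq => _; [move=> [|[]]|move=> []]; exact: sub.
rewrite -leNgt => ay; exists (j, y ord0 j - c ord0 j < 0) => //=.
have Sy : S j (y ord0 j - c ord0 j < 0) y.
  by split => //; rewrite -normrEsign ?num_real.
by case: eqVneq Sy => [<-|_] Sy; right; [right|].
Qed.

(** * Nested cells in a chart *)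

(** Concentric cells of a chart, without reference to coordinates: [K i] is a
closed hull of the open cell [B i], and [q i] lies outside [B i] but in all the
larger cells. *)
Record nested_cells (T : topologicalType) (V : set T) (K B : nat -> set T)
    (q : nat -> T) : Prop := NestedCells {
  cells_open : open V ;
  cell_open : forall i, open (B i) ;
  cell_hull_closed : forall i, closed (K i) ;
  cell_sub_hull : forall i, B i `<=` K i ;
  hull_sub : forall i, K i `<=` V ;
  cell_mono : forall i j, (i <= j)%N -> B i `<=` B j ;
  shell_connected : forall i, connected (V `\` B i) ;
  shell_point : forall i, (V `\` B i) (q i) ;
  shell_point_next : forall i, B i.+1 (q i) }.

(** The cells are the images under the inverse chart of cubes whose radii [rho i]
increase strictly and stay below the radius [r] of a cube inside the chart.
Their hulls are closed because they are compact in a Hausdorff space. *)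
Lemma nested_cells_exist (R : realType) n (T : topologicalType) (x : T)
    (U : set T) : (2 <= n)%N -> topological_manifold R n T -> nbhs x U ->
  exists V K B q, V `<=` U /\ nested_cells V K B q.
Proof.
case: n => [|n]// n2 [hT _ /(_ x)[W [phi [psi]]]].
move=> [[oW Wx] ophi cphi cpsi phiK] xU.
have cphi' y : W y -> {for y, continuous phi}.
  move: cphi; rewrite continuous_open_subspace// => + Wy; apply.
  exact/mem_set.
have cpsi' y : (phi @` W) y -> {for y, continuous psi}.
  move: cpsi; rewrite continuous_open_subspace// => + Wy; apply.
  exact/mem_set.
set c := phi x.
have pWc : (phi @` W) c by exists x.
have : nbhs c (phi @` W `&` psi @^-1` U).
  apply: filterI; first exact: open_nbhs_nbhs.
  by apply: (cpsi' _ pWc); rewrite phiK.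
move=> /nbhs_ballP[r /= r0]; rewrite -cube_ball// => rU.
pose rho (i : nat) : R := r * (1 - i.+2%:R^-1).
have rho0 i : 0 < rho i by rewrite mulr_gt0// subr_gt0 invf_lt1// ltr1n.
have rhor i : rho i < r by rewrite -[ltRHS]mulr1 ltr_pM2l// gtrBl invr_gt0.
have rho_lt i j : (i < j)%N -> rho i < rho j.
  by move=> ij; rewrite ltr_pM2l// ltrD2l ltrN2 ltf_pV2 ?posrE// ltr_nat.
pose q i : 'rV[R]_n.+1 := \row_l (c ord0 l + rho i).
have qc i l : `|q i ord0 l - c ord0 l| = rho i.
  by rewrite mxE [c _ _ + _]addrC addrK gtr0_norm.
have subr a : a <= r -> cube c a `<=` cube c r.
  by move=> ar y cy j; rewrite (lt_le_trans (cy j)).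
have psiK y : cube c r y -> phi (psi y) = y.
  by move=> /rU[[w Ww <-] _]; rewrite phiK.
have psiW y : cube c r y -> W (psi y).
  by move=> /rU[[w Ww <-] _]; rewrite phiK.
have cpsir A : A `<=` cube c r -> {within A, continuous psi}.
  move=> Ar; apply: continuous_in_subspaceT => y /set_mem /Ar /rU[yW _].
  exact: cpsi'.
have open_cell a : 0 < a -> a <= r -> open (psi @` cube c a).
  move=> a0 ar; rewrite (_ : _ @` _ = W `&` phi @^-1` ball c a).
    move: cphi; rewrite continuous_open_subspace// continuous_inP//; apply.
    exact: ball_open.
  rewrite -cube_ball//; apply/seteqP; split=> [_ [y cy <-]|y [Wy cy]].
    by split; [exact/psiW/(subr a)|rewrite /preimage/= psiK//; exact: (subr a)].
  by exists (phi y) => //; exact: phiK.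
have psi_inj y z : cube c r y -> cube c r z -> psi y = psi z -> y = z.
  by move=> cy cz /(congr1 phi); rewrite !psiK.
have cubeq i : cube c r (q i) by move=> l; rewrite qc.
pose C i := [set y : 'rV[R]_n.+1 | forall j, `|y ord0 j - c ord0 j| <= rho i].
exists (psi @` cube c r), (fun i => psi @` C i),
  (fun i => psi @` cube c (rho i)), (psi \o q); split.
  by move=> _ [y /rU[_ Uy] <-].
have subC i : C i `<=` cube c r.
  by move=> y cy j; rewrite (le_lt_trans (cy j)).
split.
- exact: open_cell.
- by move=> i; apply: open_cell => //; exact: ltW.
- move=> i; apply: compact_closed => //; apply: continuous_compact.
    exact: cpsir.
  exact: closed_cube_compact.
- by move=> i; apply: image_subset => y cy j; exact: ltW.
- by move=> i; apply: image_subset.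
- move=> i j ij; apply: image_subset => y cy l.
  rewrite (lt_le_trans (cy l))//.
  by move: ij; rewrite leq_eqVlt => /orP[/eqP->//|/rho_lt/ltW].
- move=> i; rewrite (_ : _ `\` _ = psi @` (cube c r `\` cube c (rho i))).
    apply: connected_continuous_connected.
      by apply: cube_shell_connected => //; rewrite rho0 rhor.
    by apply: cpsir => y [].
  apply/seteqP; split=> [_ [[y cy <-] nc]|_ [y [cy nc] <-]].
    by exists y => //; split=> // cy'; apply: nc; exists y.
  split; first by exists y.
  move=> [z cz] /psi_inj -/(_ (subr _ (ltW (rhor i)) _ cz) cy) zy.
  by apply: nc; rewrite -zy.
- move=> i; split; first by exists (q i).
  move=> [z cz] /psi_inj -/(_ (subr _ (ltW (rhor i)) _ cz) (cubeq i)) zq.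
  by have := cz ord0; rewrite zq qc ltxx.
- by move=> i; exists (q i) => // l; rewrite qc rho_lt.
Qed.

(** * Continua avoiding an itinerary of cells *)

Definition itinerary_avoiding (T : Type) (f : T -> T) (B : nat -> set T)
    (s : nat -> nat) (m : nat) : set T :=
  [set x | forall j, (j < m)%N -> ~ B (s j) (iter j f x)].

Lemma continuous_iter (T : topologicalType) (f : T -> T) m :
  continuous f -> continuous (iter m f).
Proof.
move=> cf; elim: m => [|m IH] x /=; first exact: cvg_id.
exact: (continuous_comp (IH x) (cf _)).
Qed.

Lemma iterK (T : Type) (f g : T -> T) m :
  cancel f g -> cancel (iter m f) (iter m g).
Proof. by move=> fK; elim: m => // m IH x; rewrite iterSr iterS fK IH. Qed.

Section itineraries.
Context (T : topologicalType) (f g : T -> T) (V : set T) (K B : nat -> set T)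
  (q : nat -> T).
Hypotheses (cf : continuous f) (cg : continuous g) (fK : cancel f g)
  (gK : cancel g f).
Hypothesis V_wander : forall m y, (0 < m)%N -> V y -> ~ V (iter m f y).
Hypothesis cells : nested_cells V K B q.
Hypothesis T_connected : connected [set: T].

Let BV i : B i `<=` V.
Proof. by move=> x /(cell_sub_hull cells) /(hull_sub cells). Qed.

Lemma cell_escape m y i : (0 < m)%N -> V y -> ~ B i (iter m f y).
Proof. by move=> m0 Vy /BV; exact: V_wander. Qed.

(** By induction on [m]: the next hole is the preimage of [B (s m)] under
[iter m f], and since [V] wanders, the preimage of the whole of [V] is still
untouched by the earlier holes.  So the hole has an intact shell around it. *)
Lemma itinerary_avoiding_connected s m :
  connected (itinerary_avoiding f B s m).
Proof.
elim: m => [|m IH].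
  rewrite (_ : itinerary_avoiding _ _ _ _ = setT)//.
  by apply/seteqP; split=> x.
have pre_open A : open A -> open (iter m f @^-1` A).
  by move=> oA; apply: open_comp => // x _; exact: continuous_iter.
rewrite (_ : itinerary_avoiding _ _ _ _ =
    itinerary_avoiding f B s m `\` (iter m f @^-1` B (s m))).
  have shellE : (iter m f @^-1` V) `\` (iter m f @^-1` B (s m)) =
      iter m g @` (V `\` B (s m)).
    apply/seteqP; split=> [x Hx|_ [x Hx <-]].
      by exists (iter m f x) => //; exact: iterK.
    by rewrite /preimage/= /setD/= !(iterK m gK).
  apply: (@connected_setD _ _ (iter m f @^-1` V)
    (iter m f @^-1` K (s m))) => //.
  - rewrite shellE; apply: connected_continuous_connected.
      exact: shell_connected cells _.
    by apply: continuous_subspaceT; exact: continuous_iter.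
  - rewrite shellE; exists (iter m g (q (s m))), (q (s m)) => //.
    exact: shell_point cells _.
  - exact/pre_open/(cells_open cells).
  - apply: preimage_closed; last exact: cell_hull_closed cells _.
    by move=> x _; exact: continuous_iter.
  - exact/pre_open/(cell_open cells).
  - by move=> x; exact: cell_sub_hull cells _ _.
  - by move=> x; exact: hull_sub cells _ _.
  - move=> x Vx j jm /BV Vj; apply: (@V_wander (m - j) _ _ Vj).
      by rewrite subn_gt0.
    by rewrite -iterD subnK// ltnW.
apply/seteqP; split=> [x Hx|x [Hx Bx] j]; last first.
  by rewrite ltnS leq_eqVlt => /orP[/eqP->//|]; exact: Hx.
by split=> [j jm|]; apply: Hx => //; exact: ltnW.
Qed.

Lemma itinerary_avoiding_closed s m : closed (itinerary_avoiding f B s m).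
Proof.
rewrite (_ : itinerary_avoiding _ _ _ _ =
   \bigcap_(j in [set j | (j < m)%N]) (iter j f @^-1` ~` B (s j))).
  apply: closed_bigI => j _; apply: preimage_closed.
    by move=> x _; exact: continuous_iter.
  exact/open_closedC/(cell_open cells).
by apply/seteqP; split=> x Hx j; exact: Hx.
Qed.

(** Pulled back by [iter j f], the shell point avoids the hole of time [j], and it
meets no hole of another time since its orbit is in [V] at time [j] only. *)
Lemma itinerary_avoiding_shell_point s m j : (j < m)%N ->
  (iter j f @` itinerary_avoiding f B s m) (q (s j)).
Proof.
move=> jm; exists (iter j g (q (s j))); last exact: iterK.
have [Vq Bq] := shell_point cells (s j).
move=> i im; have [ij|ji|->] := ltngtP i j; last by rewrite (iterK _ gK).
- rewrite -(subnKC (ltnW ij)) iterD (iterK _ gK) => /BV VB.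
  apply: (V_wander (m := j - i) _ VB); first by rewrite subn_gt0.
  by rewrite subnKC ?(iterK _ gK)// ltnW.
- rewrite -(subnK (ltnW ji)) iterD (iterK _ gK).
  by apply: cell_escape => //; rewrite subn_gt0.
Qed.

Lemma itinerary_avoiding_neq0 s m : itinerary_avoiding f B s m !=set0.
Proof.
by have [x Hx _] := itinerary_avoiding_shell_point s (ltn0Sn m);
  exists x => j jm; apply: Hx; exact: ltnW.
Qed.

End itineraries.

Lemma iter_subcontinuum_mapE (R : realType) (M : metricType R)
    (cM : compact [set: M]) (f : M -> M) (cf : continuous f) m
    (A : subcontinuum cM) :
  iter m (subcontinuum_map cM cf) A = iter m f @` A :> set M.
Proof.
elim: m => [|m IH] /=; first by rewrite image_id.
by rewrite IH image_comp.
Qed.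

(** * Entropy *)

Lemma separated_family (R : realType) (Z : metricType R) (h : Z -> Z)
    (I : finType) (k : I -> Z) m (e : R) : 0 < e ->
  (forall s t, s != t -> exists2 j, (j < m)%N &
     e <= mdist (iter j h (k s)) (iter j h (k t))) ->
  exists2 E : {fset Z}, Defs.separated h m e E & #|` E| = #|I|.
Proof.
move=> e0 H.
have H' s t : s != t -> e <= bowen_dist h m (k s) (k t).
  move=> /H[j jm /le_trans]; apply.
  exact: (@le_bigmax _ _ _ _
    (fun j : 'I_m => mdist (iter j h (k s)) (iter j h (k t))) (Ordinal jm)).
have k_inj : injective k.
  move=> s t kst; apply/eqP; apply: contraT => st.
  by have [j _] := H _ _ st; rewrite kst mdistxx leNgt e0.
exists [fset k s | s in I]%fset; last by rewrite card_imfset//= cardE.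
move=> _ _ /imfsetP[s _ ->] /imfsetP[t _ ->] st; apply: H'.
by apply: contraNneq st => ->.
Qed.

(** Separation at scale [e] persists at smaller scales, so the growth rate of [sep]
is at least [ln k] at all scales below [e]; and [k] is arbitrary. *)
Lemma entropy_pinfty (R : realType) (Z : metricType R) (g : Z -> Z) :
  (forall k : nat, exists2 e : R, 0 < e &
    forall m, exists2 E : {fset Z},
      Defs.separated g m e E & (k ^ m <= #|` E|)%N) ->
  topological_entropy g = +oo%E.
Proof.
move=> H; apply: cvg_lim => //; apply/cvgeyPge => A.
(* The logarithm of this number of letters is above [A]. *)
have [e e0 He] := H (Num.truncn (expR A)).+1.
near=> d.
have de : d <= e by near: d; exact: nbhs_right_le.
rewrite /limn_esup limf_esupE; apply: le_ereal_inf_tmp => /= _ [X [N _ NX] <-].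
have [E Esep Ecard] := He N.+1.
have XN : X N.+1 by apply: NX => /=.
apply: le_trans (ereal_sup_ubound _) => /=; last by exists N.+1 => //.
have le_sep : (((Num.truncn (expR A)).+1 ^ N.+1)%:R%:E <= sep g N.+1 d)%E.
  apply: (@le_trans _ _ (#|` E|)%:R%:E); first by rewrite lee_fin ler_nat.
  apply: ereal_sup_ubound; exists E => // x y xE yE xy.
  by apply: le_trans de _; exact: Esep.
have kn0 : (0 < ((Num.truncn (expR A)).+1 ^ N.+1)%:R :> R).
  by rewrite ltr0n expn_gt0.
apply: (@le_trans _ _ (lne ((Num.truncn (expR A)).+1 ^ N.+1)%:R%:E
                       * (N.+1%:R^-1)%:E)%E).
  rewrite lne_EFin// -EFinM lee_fin natrX lnXn ?ltr0n// -(mulr_natr (ln _)).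
  rewrite mulfK ?pnatr_eq0//.
  by rewrite -[leLHS]expRK ler_ln ?posrE ?expR_gt0 ?ltr0n// ltW// truncnS_gt.
apply: lee_wpmul2r; first by rewrite lee_fin invr_ge0.
rewrite lee_lne// in_itv /= ?leey ?andbT ?lee_fin ?ler0n//.
by apply: le_trans le_sep; rewrite lee_fin.
Unshelve. all: by end_near.
Qed.

Theorem theorem1 (R : realType) (n : nat) (M : metricType R)
    (n_ge2 : (2 <= n)%N)
    (M_manifold : topological_manifold R n M)
    (M_compact : compact [set: M])
    (M_connected : connected [set: M])
    (f : M -> M) (f_homeo : homeomorphism f)
    (f_wandering : exists x : M, wandering f x) :
  topological_entropy (subcontinuum_map M_compact (proj1 f_homeo)) = (+oo)%E.
Proof.
have [cf [g [cg fK gK]]] := f_homeo.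
have [x [U xU Uw]] := f_wandering.
have [V [K [B [q [VU cells]]]]] := nested_cells_exist n_ge2 M_manifold xU.
have V_wander m y : (0 < m)%N -> V y -> ~ V (iter m f y).
  move=> m0 Vy Vfy; have /seteqP[+ _] := Uw m m0.
  apply; split; last exact: VU Vfy.
  by exists y => //; exact: VU.
pose A s m := Subcontinuum M_compact
  (itinerary_avoiding_neq0 gK V_wander cells s m)
  (@itinerary_avoiding_closed _ _ _ _ _ _ cf cells s m)
  (@itinerary_avoiding_connected _ _ _ _ _ _ _
    cf cg fK gK V_wander cells M_connected s m).
apply: entropy_pinfty => k.
(* Only letters below [k] are used, so one radius serves all the shell points. *)
have [e e0 qe] : exists2 e : R, 0 < e &
    forall i y, (i < k)%N -> mdist (q i) y < e -> B i.+1 y.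
  elim: k => [|k [e e0 IH]]; first by exists 1.
  have /nbhs_ballP[d /= d0 qd] : nbhs (q k) (B k.+1).
    apply: open_nbhs_nbhs; split; first exact: cell_open cells _.
    exact: shell_point_next cells _.
  exists (Num.min e d) => [|i y]; first by rewrite lt_min e0.
  rewrite lt_min ltnS leq_eqVlt => /orP[/eqP->|ik] /andP[ye yd].
    by apply: qd; rewrite ballEmdist.
  exact: IH.
exists e => // m.
pose word (s : {ffun 'I_m -> 'I_k}) i :=
  oapp (fun j => s j : nat) 0%N (insub i).
have wordE s (j : 'I_m) : word s j = s j by rewrite /word valK.
pose F := subcontinuum_map M_compact (proj1 f_homeo).
have dist s t j : (j < m)%N -> (s j < t j)%N -> (s j < k)%N ->
    e <= mdist (iter j F (A s m)) (iter j F (A t m)).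
  move=> jm stj sk; rewrite mdist_subcontinuumE leNgt; apply/negP.
  move=> /hausdorff_dist_lt[+ _] => /(_ (q (s j))).
  rewrite !iter_subcontinuum_mapE => -[|_ [y Ay <-] /(qe _ _ sk) By].
    exact: (itinerary_avoiding_shell_point gK V_wander cells).
  by apply: (Ay j jm); exact: (cell_mono cells stj).
have [s t st|E Esep Ecard] := @separated_family R _ F _
    (fun s => A (word s) m) m e e0; last first.
  by exists E => //; rewrite Ecard card_ffun !card_ord.
have [j stj] : exists j, s j != t j.
  apply/existsP; apply: contraNT st; rewrite negb_exists => /forallP st.
  by apply/eqP/ffunP => j; apply/eqP; rewrite -[_ == _]negbK.
exists j => //; have := stj; rewrite -val_eqE neq_ltn => /orP[] lt_st.
  by apply: dist; rewrite ?wordE.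
by rewrite metric_sym; apply: dist; rewrite ?wordE.
Qed.
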